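(* Let $G$ be an Abelian, Hausdorff, locally compact, second-countable topological group. Let $\mathrm{P}$ be a ($\sigma$-finite) stationary measure on $\mathrm{M}(G)$ with Palm measure $\mathrm{P}_0$, and let $\nu$ be a ($\sigma$-finite) weakly-stationary measure on $\mathrm{F}(G)$. Let $\mathrm{P}_0^\nu$ be the push-forward of the product measure $\mathrm{P}_0\otimes\nu$ by the map $\Gamma:\mathrm{M}(G)\times\mathrm{F}(G)\to\mathrm{M}(G)$, where $\Gamma(\xi,B)$ is the push-forward of $\xi$ by $t\mapsto t+B_t$. If $\mathrm{P}_0^\nu$ is $\sigma$-finite, then there exists a $\sigma$-finite stationary measure $\mathrm{P}^\nu$ on $\mathrm{M}(G)$ such that $\mathrm{P}_0^\nu$ is the Palm measure of $\mathrm{P}^\nu$.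
   Context: $G$ is written additively and $\lambda_G$ is a fixed Haar measure on $G$. $\mathrm{M}(G)$ is the space of locally finite (finite on compact sets) positive Borel measures on $G$, with the $\sigma$-algebra $\mathcal{M}(G)$ generated by the maps $\xi\mapsto\xi(K)$, $K\subset G$ compact; $\emptyset$ denotes the zero measure. For $t\in G$, $\tau_t:\mathrm{M}(G)\to\mathrm{M}(G)$ is $\tau_t\xi(\cdot)=\xi(\cdot+t)$. A $\sigma$-finite (not necessarily finite) measure $\mathrm{P}$ on $\mathrm{M}(G)$ is stationary if its push-forward by $\tau_t$ equals $\mathrm{P}$ for all $t\in G$. The Palm measure of a stationary $\mathrm{P}$ is the $\sigma$-finite measure $$\mathrm{P}_0(A)=\int_{\mathrm{M}(G)}\int_G\omega(t)\,\mathbf{1}(\tau_t\xi\in A)\,\xi(\mathrm{d}t)\,\mathrm{P}(\mathrm{d}\xi),\quad A\in\mathcal{M}(G),$$ where $\omega:G\to[0,\infty)$ is any measurable function with $\int_G\omega\,\mathrm{d}\lambda_G=1$ (the result does not depend on $\omega$). Standing assumption: stationary measures satisfy $\mathrm{P}(\{\emptyset\})=0$. $\mathrm{F}(G)$ is the space of continuous functions $B:G\to G$, $t\mapsto B_t$, such that $B_0=0$ and, for every $\xi\in\mathrm{M}(G)$, the push-forward of $\xi$ by $\mathrm{Id}+B$ is locally finite, i.e. $\int_G\mathbf{1}_K(t+B_t)\,\xi(\mathrm{d}t)<\infty$ for every compact $K\subset G$. It carries the cylindrical $\sigma$-algebra $\mathcal{F}(G)$ (generated by the evaluations $B\mapsto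 B_t$). For $t\in G$, $\theta_t:\mathrm{F}(G)\to\mathrm{F}(G)$ is $\theta_tB=(B_{t+s}-B_t)_{s\in G}$. A $\sigma$-finite measure $\nu$ on $\mathrm{F}(G)$ (not necessarily finite) is weakly-stationary if its push-forward by $\theta_t$ equals $\nu$ for all $t\in G$. The map $\Gamma$ is measurable, so $\mathrm{P}_0^\nu$ is well defined. *)

(* Defs.v *)
From HB Require Import structures.
From mathcomp Require Import all_boot all_order all_algebra.
From mathcomp Require Import all_classical all_reals all_analysis measurable_realfun.

Set Implicit Arguments.
Unset Strict Implicit.
Unset Printing Implicit Defensive.

Import Order.TTheory GRing.Theory Num.Theory.
Import numFieldNormedType.Exports.

Local Open Scope classical_set_scope.
Local Open Scope ring_scope.

(* An alias is needed because g_sigma_algebraType wants a pointed type, and a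
   topologicalZmodType has no declared point. *)
Definition borel (G : topologicalZmodType) : Type := G.

Section borel.
Variable G : topologicalZmodType.

HB.instance Definition _ := TopologicalZmodule.on (borel G).
HB.instance Definition _ := isPointed.Build (borel G) (0 : G).
HB.instance Definition _ := @isMeasurable.Build (sigma_display (@open G))
  (borel G) <<s @open G >> (@sigma_algebra0 _ setT (@open G))
  (@sigma_algebraC (borel G) (@open G)) (@sigma_algebra_bigcup _ setT (@open G)).

Lemma continuous_borel_measurable (f : G -> G) : continuous f ->
  measurable_fun [set: borel G] (f : borel G -> borel G).
Proof.
move=> /continuousP cf.
apply: (@measurability _ _ (borel G) (borel G) setT f (@open G)) => //.
move=> _ [U oU <-]; rewrite setTI; apply: sub_sigma_algebra.
exact: cf.
Qed.

Lemma translation_continuous (u : G) : continuous (fun s : G => s + u).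
Proof.
move=> s; apply: (@continuous_comp _ _ _ (fun s : G => (s, u))
    (fun x : G * G => x.1 + x.2)).
  by apply: cvg_pair => /=; [exact: cvg_id|exact: cvg_cst].
exact: add_continuous.
Qed.

Lemma displacement_continuous (B : G -> G) : continuous B ->
  continuous (fun t : G => t + B t).
Proof.
move=> cB t; apply: (@continuous_comp _ _ _ (fun s : G => (s, B s))
    (fun x : G * G => x.1 + x.2)).
  by apply: cvg_pair => /=; [exact: cvg_id|exact: cB].
exact: add_continuous.
Qed.

Lemma compact_translate_preimage (u : G) (K : set G) : compact K ->
  compact ((fun s : G => s + u) @^-1` K).
Proof.
move=> cK; rewrite (_ : _ @^-1` _ = (fun s : G => s + - u) @` K).
  apply: continuous_compact => //; apply: continuous_subspaceT.
  exact: translation_continuous.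
apply/seteqP; split => [s Ks|_ [s Ks <-]] /=; last by rewrite subrK.
by exists (s + u) => //; rewrite addrK.
Qed.

End borel.

(* As everywhere in the library, a measure is a function on all sets of which
   only the values on measurable sets matter. The sigma-algebra on lfmeasure is
   generated by values on compact sets, so when G is Hausdorff it does not
   separate two measures that agree on the Borel sets. *)
Record lfmeasure (G : topologicalZmodType) (R : realType) := LFMeasure {
  lf_measure :> {measure set (borel G) -> \bar R} ;
  lf_compact : forall K : set G, compact K -> (lf_measure K < +oo)%E }.

Section lfmeasure.
Variables (G : topologicalZmodType) (R : realType).
Local Notation M := (lfmeasure G R).

Lemma mzero_lf (K : set G) : compact K ->
  ((mzero : {measure set (borel G) -> \bar R}) K < +oo)%E.
Proof. by move=> _; exact: ltry. Qed.

HB.instance Definition _ := gen_eqMixin M.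
HB.instance Definition _ := gen_choiceMixin M.
HB.instance Definition _ := isPointed.Build M (LFMeasure mzero_lf).

Definition lfmeasure_gen : set_system M :=
  \bigcup_(K in [set K : set G | compact K])
    preimage_set_system [set: M] (fun xi : M => xi K)
      (measurable : set (set (\bar R))).

HB.instance Definition _ := @isMeasurable.Build (sigma_display lfmeasure_gen)
  M <<s lfmeasure_gen >> (@sigma_algebra0 _ setT lfmeasure_gen)
  (@sigma_algebraC M lfmeasure_gen) (@sigma_algebra_bigcup _ setT lfmeasure_gen).

Definition null_lfmeasure : set M :=
  [set xi | forall A : set (borel G), measurable A -> xi A = 0%E].

Section lfpush.
Variables (xi : M) (f : G -> G).
Hypothesis cf : continuous f.
Hypothesis ff : forall K : set G, compact K -> (xi (f @^-1` K) < +oo)%E.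

Definition lfpush : M := @LFMeasure G R
  (measure_function_pushforward__canonical__measure_function_Measure
    xi (continuous_borel_measurable cf)) ff.

End lfpush.

Lemma tau_lf (t : G) (xi : M) (K : set G) : compact K ->
  (xi ((fun s : G => s + - t)%R @^-1` K) < +oo)%E.
Proof. by move=> cK; apply/lf_compact/compact_translate_preimage. Qed.

(* tau t xi A = xi (A + t), as s is in A + t iff s - t is in A. *)
Definition tau (t : G) (xi : M) : M :=
  lfpush (@translation_continuous G (- t)) (@tau_lf t xi).

(* The second clause, no mass on the zero measure, is a standing assumption on
   all stationary measures. *)
Definition stationary (P : set M -> \bar R) :=
  (forall (t : G) (A : set M), measurable A -> pushforward P (tau t) A = P A) /\
  P null_lfmeasure = 0%E.

(* No regularity clause: on a locally compact Hausdorff second-countable space,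
   every Borel measure that is finite on compact sets is regular. *)
Definition haar_measure (lambda : M) :=
  (exists2 A : set (borel G), measurable A & lambda A != 0%E) /\
  (forall (t : G) (A : set (borel G)), measurable A -> tau t lambda A = lambda A).

(* For a stationary P the right-hand side does not depend on omega; the equation
   is asked for every admissible omega. *)
Definition is_palm_measure (lambda : M) (P P0 : set M -> \bar R) :=
  forall omega : borel G -> R,
    measurable_fun [set: borel G] omega -> (forall t, 0 <= omega t) ->
    (\int[lambda]_t (omega t)%:E = 1)%E ->
  forall A : set M, measurable A ->
    P0 A = (\int[P]_xi \int[xi]_t (omega t * \1_A (tau t xi))%R%:E)%E.

End lfmeasure.

Record displacement (G : topologicalZmodType) (R : realType) := Displacement {
  disp_fun :> G -> G ;
  disp_continuous : continuous disp_fun ;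
  disp0 : disp_fun 0 = 0 ;
  disp_lf : forall (xi : lfmeasure G R) (K : set G), compact K ->
    (xi ((fun t => t + disp_fun t)%R @^-1` K) < +oo)%E }.

Section displacement.
Variables (G : topologicalZmodType) (R : realType).
Local Notation M := (lfmeasure G R).
Local Notation F := (displacement G R).

Lemma disp_zero_lf (xi : M) (K : set G) : compact K ->
  (xi ((fun t => t + cst 0 t)%R @^-1` K) < +oo)%E.
Proof.
move=> cK; rewrite (_ : _ @^-1` _ = K); first exact: lf_compact.
by apply/seteqP; split => t /=; rewrite addr0.
Qed.

HB.instance Definition _ := gen_eqMixin F.
HB.instance Definition _ := gen_choiceMixin F.
HB.instance Definition _ := isPointed.Build F
  (Displacement (@cst_continuous G G 0) erefl disp_zero_lf).

Definition displacement_gen : set_system F :=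
  \bigcup_(t in [set: G])
    preimage_set_system [set: F] (fun B : F => B t : borel G)
      (measurable : set (set (borel G))).

HB.instance Definition _ := @isMeasurable.Build (sigma_display displacement_gen)
  F <<s displacement_gen >> (@sigma_algebra0 _ setT displacement_gen)
  (@sigma_algebraC F displacement_gen)
  (@sigma_algebra_bigcup _ setT displacement_gen).

Lemma theta_continuous (t : G) (B : F) : continuous (fun s : G => B (t + s) - B t).
Proof.
move=> s; apply: (@continuous_comp _ _ _ (fun s : G => B (t + s))
    (fun x : G => x - B t)); last exact: translation_continuous.
apply: (@continuous_comp _ _ _ (fun s : G => t + s) B);
  last exact: disp_continuous.
rewrite (_ : (fun s : G => t + s) = fun s : G => s + t).
  exact: translation_continuous.
by apply/funext => r; rewrite addrC.
Qed.

Lemma theta0 (t : G) (B : F) : B (t + 0) - B t = 0.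
Proof. by rewrite addr0 subrr. Qed.

Lemma theta_lf (t : G) (B : F) (xi : M) (K : set G) : compact K ->
  (xi ((fun s => s + (B (t + s) - B t))%R @^-1` K) < +oo)%E.
Proof.
move=> cK.
have /(disp_lf B (tau (- t) xi)) :=
  @compact_translate_preimage G (- (t + B t)) K cK.
rewrite /tau /lfpush /= /pushforward -comp_preimage.
congr (_ < _)%E; congr (xi _); congr (_ @^-1` K); apply/funext => s /=.
by rewrite opprK opprD addrACA addrK (addrC t s).
Qed.

Definition theta (t : G) (B : F) : F :=
  Displacement (@theta_continuous t B) (@theta0 t B) (@theta_lf t B).

Definition weakly_stationary (nu : set F -> \bar R) :=
  forall (t : G) (A : set F), measurable A -> pushforward nu (theta t) A = nu A.

Definition Gamma (p : M * F) : M :=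
  lfpush (displacement_continuous (@disp_continuous G R p.2))
    (@disp_lf G R p.2 p.1).

End displacement.

(* Main.v *)
Require Import Defs.
From HB Require Import structures.
From mathcomp Require Import all_boot all_order all_algebra.
From mathcomp Require Import finmap all_classical all_reals all_analysis measurable_realfun.

(** Write [tau t xi] for the configuration [xi] seen from [t], [N] for the set
    of null configurations and [Q] for the displaced measure, the image of
    [P0 x nu] under [Gamma].

    Two identities carry the proof.  The refined Campbell identity
      int P(dxi) int xi(dt) f(tau t xi, t) = int P0(dxi) int lambda(dt) f(xi, t)
    holds for all nonnegative measurable [f] as soon as [P] is stationary with
    Palm measure [P0] (lemma [palm_campbell]): stationarity makes the left side
    invariant under the change of the second argument into [t + u], and
    averaging over [u] against a symmetric probability density leads to the
    definition of the Palm measure.  It gives Mecke's identity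
      int P0(dxi) int xi(dt) h(tau t xi, - t) = int P0(dxi) int xi(dt) h(xi, t),
    which expresses that a pair of points of the configuration may be
    exchanged (lemma [campbell_mecke]).

    Mecke's identity passes from [P0] to [Q] (lemma [mecke_displaced]).  The
    point [t] of [xi] becomes the point [t + B t] of [Gamma (xi, B)], and
      tau (t + B t) (Gamma (xi, B)) = Gamma (tau t xi, theta t B),
      - (t + B t) = - t + (theta t B) (- t),
    so that, after weak stationarity has replaced [theta t B] by [B], Mecke's
    identity for [Q] and [h] is the one for [P0] and the function
    [(xi, t) |-> int nu(dB) h(Gamma (xi, B), t + B t)].

    Conversely (lemma [mecke_palm_inversion]), a sigma-finite [Q] that satisfies
    Mecke's identity and does not charge [N] is a Palm measure.  Choose a weight
    [k >= 0] with [int xi(dt) k(xi, t) = 1] for every [xi] outside [N], and put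
      P(A) = int Q(deta) int lambda(ds) k(tau (-s) eta, s) 1_A(tau (-s) eta).
    Mecke's identity and the invariance of [lambda] give the Campbell identity
    for [P] and [Q].  Everything else follows from it: [P] has Palm measure [Q];
    [P] does not depend on [k], and translating [P] amounts to translating [k],
    whence stationarity; and [P] is sigma-finite because [Q] is. *)

Set Implicit Arguments.
Unset Strict Implicit.
Unset Printing Implicit Defensive.

Import Order.TTheory GRing.Theory Num.Theory.
Import numFieldNormedType.Exports.

Local Open Scope classical_set_scope.
Local Open Scope ring_scope.

(** * Locally compact second-countable groups *)

Record lcsc_group (G : topologicalZmodType) : Prop := LcscGroup {
  lcsc_hausdorff : hausdorff_space G ;
  lcsc_locally_compact : locally_compact [set: G] ;
  lcsc_second_countable : @second_countable G }.

Section topology.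
Variable G : topologicalZmodType.
Hypothesis hG : lcsc_group G.

Let closed_of_compact (K : set G) : compact K -> closed K.
Proof. by apply: compact_closed; exact: (lcsc_hausdorff hG). Qed.

Lemma countable_base : exists V : nat -> set G,
  (forall n, open (V n)) /\
  (forall x U, nbhs x U -> exists n, V n x /\ V n `<=` U).
Proof.
have [B cB [oB bB]] := lcsc_second_countable hG.
have /pfcard_geP[B0|[V]] := cB.
  have [W [+ _] _] := bB (0 : G) setT filterT.
  by rewrite B0.
exists V; split => [n|x U /bB[W [BW Wx] WU]].
  by apply: oB; exact: funS.
have [n _ VnW] := 'surj_V BW.
by exists n; rewrite VnW.
Qed.

Lemma compact_nbhs (x : G) (U : set G) : nbhs x U ->
  exists K, [/\ nbhs x K, compact K & K `<=` U].
Proof.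
move=> xU.
have [K xK [cK clK]] : exists2 K, nbhs x K & compact K /\ closed K.
  by have := @lcsc_locally_compact _ hG x Logic.I; rewrite withinET.
have [W xW WU] := compact_regular (lcsc_hausdorff hG) cK xK xU.
exists (closure W `&` K); split => [| |y [/WU]//].
  by apply: filterI => //; apply: filterS xW; exact: subset_closure.
apply: (subclosed_compact _ cK) => [|y []//].
by apply: closedI => //; exact: closed_closure.
Qed.

(** Among the sets of a countable base, keep those that lie between [set0] and a
    compact subset of [U], and enlarge each of them to such a compact set. *)
Lemma open_sigma_compact (U : set G) : open U ->
  exists2 K : nat -> set G, forall n, compact (K n) & U = \bigcup_n K n.
Proof.
move=> oU; have [V [oV bV]] := countable_base.
have /choice[K HK] n : exists K : set G, [/\ compact K, K `<=` U &
    forall L, compact L -> L `<=` U -> V n `<=` L -> V n `<=` K].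
  have [[L [cL LU VL]]|noL] :=
    pselect (exists L, [/\ compact L, L `<=` U & V n `<=` L]).
    by exists L.
  exists set0; split => //; first exact: compact0.
  by move=> L cL LU VL; exfalso; apply: noL; exists L.
exists K => [n|]; first by have [] := HK n.
apply/seteqP; split => [x Ux|x [n _]]; last by have [_ + _] := HK n; exact.
have [L [xL cL LU]] := compact_nbhs (open_nbhs_nbhs (conj oU Ux)).
have [n [Vnx VnL]] := bV _ _ xL.
by exists n => //; have [_ _] := HK n; apply; [exact: cL| | |].
Qed.

Lemma compact_cover : exists2 C : nat -> set G,
  forall n, compact (C n) & \bigcup_n C n = setT.
Proof. by have [C cC CT] := open_sigma_compact openT; exists C. Qed.

Lemma compact_measurable (K : set G) : compact K ->
  measurable (K : set (borel G)).
Proof.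
move=> cK; rewrite -(setCK K); apply: measurableC; apply: sub_sigma_algebra.
have := closed_openC (closed_of_compact cK). exact.
Qed.

Lemma open_measurable_borel (U : set G) : open U ->
  measurable (U : set (borel G)).
Proof. exact: sub_sigma_algebra. Qed.

Lemma borel_generated_by_compact :
  (measurable : set (set (borel G))) = <<s [set K : set G | compact K] >>.
Proof.
apply/seteqP; split; apply: smallest_sub; first 1 last.
- move=> U /open_sigma_compact[K cK ->].
  apply: sigma_algebra_bigcup => n; apply: sub_sigma_algebra; exact: cK.
- exact: smallest_sigma_algebra.
- by move=> K; exact: compact_measurable.
- exact: smallest_sigma_algebra.
Qed.

Lemma compact_setI_closed : setI_closed [set K : set G | compact K].
Proof.
move=> K L /= cK cL; apply: compact_closedI => //.
exact: closed_of_compact.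
Qed.

(** An open set of the product is a union of rectangles with sides in a countable
    base. *)
Lemma open_prod_measurable (W : set (G * G)) : open W ->
  measurable (W : set (borel G * borel G)).
Proof.
move=> oW; have [V [oV bV]] := countable_base.
pose S n m := if pselect (V n `*` V m `<=` W) then V n `*` V m else set0.
rewrite (_ : W = \bigcup_n \bigcup_m S n m).
  apply: bigcup_measurable => n _; apply: bigcup_measurable => m _.
  rewrite /S; case: pselect => [VW|nVW] //=.
  by apply: measurableX; exact: open_measurable_borel.
apply/seteqP; split => [[x y] Wxy|p [n _ [m _]]]; last first.
  by rewrite /S; case: pselect => // VW; exact: VW.
have [[A B]/= [xA yB] ABW] : nbhs (x, y) W by exact: open_nbhs_nbhs.
have [n [Vnx VnA]] := bV _ _ xA; have [m [Vmy VmB]] := bV _ _ yB.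
exists n => //; exists m => //; rewrite /S; case: pselect => // -[].
by move=> [a b] [/= /VnA Aa /VmB Bb]; exact: (ABW (a, b)).
Qed.

Lemma measurable_continuous2 (f : G * G -> G) : continuous f ->
  measurable_fun [set: borel G * borel G] (f : borel G * borel G -> borel G).
Proof.
move=> /continuousP cf.
apply: (@measurability _ _ (borel G * borel G)%type (borel G) setT f
  (@open G)) => //.
move=> _ [U oU <-]; rewrite setTI; exact: (open_prod_measurable (cf _ oU)).
Qed.

Section borel_valued.
Context d (X : measurableType d).
Implicit Types s t : X -> borel G.

Lemma measurable_addG s t : measurable_fun setT s -> measurable_fun setT t ->
  measurable_fun setT (fun x => (s x + t x : borel G)).
Proof.
move=> ms mt.
apply: (@measurableT_comp _ _ _ _ _ _
  (fun p : borel G * borel G => p.1 + p.2 : borel G) _ (fun x => (s x, t x))).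
  by apply: measurable_continuous2; exact: add_continuous.
exact: measurable_fun_pair.
Qed.

Lemma measurable_oppG s : measurable_fun setT s ->
  measurable_fun setT (fun x => (- s x : borel G)).
Proof.
apply: measurableT_comp; apply: continuous_borel_measurable.
exact: opp_continuous.
Qed.

Lemma measurable_subG s t : measurable_fun setT s -> measurable_fun setT t ->
  measurable_fun setT (fun x => (s x - t x : borel G)).
Proof. by move=> ms mt; apply: measurable_addG => //; exact: measurable_oppG. Qed.

(** A function that is measurable in [x] and continuous in the group variable is
    jointly measurable.  By regularity, [b x r] is in the open set [U] iff some
    basic [V j] with closure inside [U] contains all values of [b x] on a
    countable dense subset of some basic neighbourhood [V n] of [r]; only
    countably many conditions are involved. *)
Lemma measurable_caratheodory (b : X -> G -> G) :
  (forall r : G, measurable_fun setT (fun x => b x r : borel G)) ->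
  (forall x, continuous (b x)) ->
  measurable_fun [set: X * borel G] (fun p => b p.1 p.2 : borel G).
Proof.
move=> mb cb; have [V [oV bV]] := countable_base.
apply: (@measurability _ _ _ (borel G) setT _ (@open G)) => //.
move=> _ [U oU <-]; rewrite setTI.
have /choice[e He] n : exists e : nat -> G, V n !=set0 ->
    (forall i, V n (e i)) /\ forall x W, V n x -> nbhs x W -> exists i, W (e i).
  have [[y Vy]|] := pselect (V n !=set0); last by exists (cst 0).
  have /choice[e He] i : exists z, V n z /\ (V i `&` V n !=set0 -> V i z).
    have [[z [? ?]]|] := pselect (V i `&` V n !=set0); first by exists z.
    by exists y.
  exists e => _; split => [i|x W Vx xW]; first by have [] := He i.
  have [i [Vix ViW]] := bV _ _ xW; exists i; apply: ViW.
  by have [_] := He i; apply; exists x.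
(* [e n] enumerates a dense subset of [V n]. *)
pose S j n := if pselect (closure (V j) `<=` U) then
  (\bigcap_i [set x | V j (b x (e n i))]) `*` V n else set0.
rewrite (_ : _ @^-1` _ = \bigcup_j \bigcup_n S j n).
  apply: bigcup_measurable => j _; apply: bigcup_measurable => n _.
  rewrite /S; case: pselect => [VU|nVU] //=.
  apply: measurableX; last exact: open_measurable_borel.
  apply: bigcap_measurable => // i _.
  rewrite -[X in measurable X]setTI; apply: mb => //.
  exact: open_measurable_borel.
apply/seteqP; split => [[x r]/= Ubxt|[x r]/= [j _ [n _]]].
- have [K [btK cK KU]] := compact_nbhs (open_nbhs_nbhs (conj oU Ubxt)).
  have [j [Vj VjK]] := bV _ _ btK.
  have [n [Vn VnV]] := bV _ _ (cb x r _ (open_nbhs_nbhs (conj (oV j) Vj))).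
  exists j => //; exists n => //; rewrite /S; case: pselect => [VU|[]].
    split => //= i _ /=; apply: (VnV (e n i)).
    by have [+ _] := He n (ex_intro _ r Vn); exact.
  apply: subset_trans KU; have /closure_id-> := closed_of_compact cK.
  exact: closureS.
- rewrite /S; case: pselect => [VjU|//] [/= Vjb Vnt]; apply: VjU => W btW.
  have [_ /(_ r ((b x @^-1` W) `&` V n) Vnt)[]] := He n (ex_intro _ r Vnt).
    by apply: filterI; [exact: cb|exact: open_nbhs_nbhs].
  by move=> i [/= Wb _]; exists (b x (e n i)); split => //; exact: Vjb.
Qed.

End borel_valued.

End topology.

(** * Integrals with respect to images, products and mixtures *)

Section measure_lemmas.
Local Open Scope ereal_scope.

Section upgrade.
Context d (T : measurableType d) (R : realType).

(** A copy of [m] that carries a proof of sigma-finiteness, so that a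
    sigma-finite measure structure can be attached to it. *)
Definition sigma_finite_copy (m : {measure set T -> \bar R})
  (sm : sigma_finite setT m) : set T -> \bar R := m.

HB.instance Definition _ m sm := Measure.on (@sigma_finite_copy m sm).
HB.instance Definition _ m sm :=
  @Measure_isSigmaFinite.Build _ _ _ (@sigma_finite_copy m sm) sm.

Lemma sigma_finite_upgrade (m : {measure set T -> \bar R}) :
  sigma_finite setT m ->
  exists m' : {sigma_finite_measure set T -> \bar R},
    m' = m :> (set T -> \bar R).
Proof. by move=> sm; exists (sigma_finite_copy sm). Qed.

End upgrade.

Section ereal_product.
Variable R : realType.
Implicit Types (c : \bar R) (u : (\bar R)^nat).

Lemma mule_nneseriesr c u : 0 <= c -> (forall n, 0 <= u n) ->
  c * (\sum_(n <oo) u n) = \sum_(n <oo) c * u n.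
Proof.
move=> c0 u0; rewrite -ge0_integral_count// -ge0_integralZl//.
by rewrite ge0_integral_count// => n; exact: mule_ge0.
Qed.

Lemma mule_limn c u : 0 <= c -> (forall n, 0 <= u n) -> nondecreasing_seq u ->
  c * limn u = limn (fun n => c * u n).
Proof.
move=> c0 u0 ndu; have cu := ereal_nondecreasing_is_cvgn ndu.
case: c c0 => [r _|_|//]; first by rewrite limeMl.
apply/esym/cvg_lim => //.
have [l0|l0] := eqVneq (limn u) 0.
  rewrite l0 mule0 (_ : (fun _ => _) = cst 0); first exact: cvg_cst.
  apply/funext => n; suff -> : u n = 0 by rewrite mule0.
  apply/eqP; rewrite eq_le u0 andbT -l0.
  by apply: lime_ge => //; exists n => // m nm; exact: ndu.
apply: cvgeM => //; last exact: cvg_cst.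
by rewrite /mule_def; case: (limn u) l0.
Qed.

End ereal_product.

Context d1 d2 (X : measurableType d1) (Y : measurableType d2) (R : realType).

Lemma tonelli (m1 : {measure set X -> \bar R}) (m2 : {measure set Y -> \bar R})
    (f : X * Y -> \bar R) :
  sigma_finite setT m1 -> sigma_finite setT m2 ->
  (forall p, 0 <= f p) -> measurable_fun setT f ->
  \int[m1]_x \int[m2]_y f (x, y) = \int[m2]_y \int[m1]_x f (x, y).
Proof.
move=> /sigma_finite_upgrade[n1 <-] /sigma_finite_upgrade[n2 <-] f0 mf.
exact: fubini_tonelli.
Qed.

Lemma measurable_integral_sigma_finite (m : {measure set Y -> \bar R})
    (f : X * Y -> \bar R) : sigma_finite setT m ->
  (forall p, 0 <= f p) -> measurable_fun setT f ->
  measurable_fun setT (fun x => \int[m]_y f (x, y)).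
Proof.
move=> /sigma_finite_upgrade[n <-] f0 mf.
exact: measurable_fun_fubini_tonelli_F.
Qed.

Lemma integral_image (m : {measure set X -> \bar R}) (n : {measure set Y -> \bar R})
    (phi : X -> Y) (f : Y -> \bar R) : measurable_fun setT phi ->
  (forall A, measurable A -> n A = m (phi @^-1` A)) ->
  (forall y, 0 <= f y) -> measurable_fun setT f ->
  \int[n]_y f y = \int[m]_x f (phi x).
Proof.
move=> mphi nE f0 mf.
rewrite (eq_measure_integral
  (measure_function_pushforward__canonical__measure_function_Measure m mphi)).
  by rewrite ge0_integral_pushforward.
by move=> A mA _; rewrite nE.
Qed.

End measure_lemmas.

Section measure_zero.
Local Open Scope ereal_scope.
Context d (T : measurableType d) (R : realType) (m : {measure set T -> \bar R}).

Lemma measure_bigcup_eq0 (F : nat -> set T) :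
  (forall n, measurable (F n)) -> (forall n, m (F n) = 0) -> m (\bigcup_n F n) = 0.
Proof.
move=> mF F0; apply/eqP; rewrite eq_le measure_ge0 andbT.
apply: (le_trans (measure_sigma_subadditive _ mF _ _)) => //.
  exact: bigcup_measurable.
by rewrite eseries0// => i _ _; rewrite F0.
Qed.

Lemma eq_integral_off_null (N : set T) (f g : T -> \bar R) :
  measurable N -> m N = 0 ->
  (forall x, 0 <= f x) -> measurable_fun setT f ->
  (forall x, 0 <= g x) -> measurable_fun setT g ->
  (forall x, ~ N x -> f x = g x) -> \int[m]_x f x = \int[m]_x g x.
Proof.
move=> mN mN0 f0 mf g0 mg fg.
rewrite (ge0_negligible_integral mN measurableT mf)//.
rewrite [RHS](ge0_negligible_integral mN measurableT mg)//.
by apply: eq_integral => x; rewrite inE => -[_ /fg].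
Qed.

Lemma integral_finite_level (f : T -> \bar R) (e : R) :
  (forall x, 0 <= f x) -> measurable_fun setT f -> \int[m]_x f x < +oo ->
  (0 < e)%R -> m [set x | e%:E <= f x] < +oo.
Proof.
move=> f0 mf fi e0; set S := [set x | _].
have mS : measurable S.
  by rewrite -[S]setTI; exact: emeasurable_fun_c_infty.
have e0' : 0 <= e%:E by rewrite lee_fin ltW.
have eS : e%:E * m S <= \int[m]_x f x.
  rewrite -[S in m S]setIT -integral_indic// -ge0_integralZl//; last first.
    exact/measurable_EFinP/measurable_indic.
  apply: ge0_le_integral => //.
  - by move=> x _; rewrite mule_ge0// lee_fin.
  - by apply: measurable_funeM; exact/measurable_EFinP/measurable_indic.
  move=> x _; rewrite indicE; have [|_] := boolP (x \in S).
    by rewrite inE mule1.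
  by rewrite mule0.
rewrite ltey; apply/eqP => mSy; move: (le_lt_trans eS fi).
by rewrite mSy gt0_muley ?lte_fin.
Qed.

(** The level sets [1 / (j + 1) <= f i] have finite measure and, together with
    [N], they cover the space. *)
Lemma sigma_finite_of_integrable (I : countType) (N : set T) (f : I -> T -> \bar R) :
  measurable N -> m N = 0 ->
  (forall i x, 0 <= f i x) -> (forall i, measurable_fun setT (f i)) ->
  (forall i, \int[m]_x f i x < +oo) ->
  (forall x, ~ N x -> exists i, f i x != 0) -> sigma_finite setT m.
Proof.
move=> mN mN0 f0 mf fi fN.
pose S n := if (choice.unpickle n : option (I * nat)) is Some (i, j) then
  [set x | (j.+1%:R^-1 : R)%:E <= f i x] else N.
(* Codes of no pair contribute [N] once more. *)
pose S' n := N `|` S n.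
exists S' => [|n].
  apply/esym; rewrite -subTset => x _.
  have [Nx|/fN[i fix0]] := pselect (N x); first by exists 0%N => //; left.
  have [j jf] : exists j, (j.+1%:R^-1 : R)%:E <= f i x.
    have := f0 i x; rewrite le_eqVlt eq_sym (negbTE fix0)/=.
    case: (f i x) => [r|_|//]; last by exists 0%N; rewrite leey.
    rewrite lte_fin => r0; exists (Num.truncn r^-1); rewrite lee_fin.
    by rewrite -[leRHS]invrK lef_pV2 ?posrE ?invr_gt0// ltW// truncnS_gt.
  by exists (choice.pickle (i, j : nat)) => //; right; rewrite /S choice.pickleK.
have [mS Sfin] : measurable (S n) /\ m (S n) < +oo.
  rewrite /S; case: choice.unpickle => [[i j]|]; last by rewrite mN0.
  split; last by apply: integral_finite_level.
  by rewrite -[X in measurable X]setTI; exact: emeasurable_fun_c_infty.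
split; first exact: measurableU.
by rewrite (le_lt_trans (measureU2 m mN mS))// [X in X + _]mN0 add0e.
Qed.

End measure_zero.

(** A mixture integrates a weight [g] along a measurable family of measures
    [kappa x], itself integrated against [mu], and transports the result by
    [phi].  Palm measures and their inversion are both of this form. *)
Section mixture.
Local Open Scope ereal_scope.
Context d1 d2 d3 (X : measurableType d1) (Y : measurableType d2)
  (Z : measurableType d3) (R : realType).
Variables (mu : {measure set X -> \bar R}) (kappa : X -> {measure set Y -> \bar R}).
Hypothesis mkappa : forall f : X * Y -> \bar R, (forall p, 0 <= f p) ->
  measurable_fun setT f -> measurable_fun setT (fun x => \int[kappa x]_y f (x, y)).
Variables (g : X * Y -> \bar R) (phi : X * Y -> Z).
Hypotheses (g0 : forall p, 0 <= g p) (mg : measurable_fun setT g).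
Hypothesis mphi : measurable_fun setT phi.

Let I (f : Z -> \bar R) := \int[mu]_x \int[kappa x]_y (g (x, y) * f (phi (x, y))).

Let mgf f : measurable_fun setT f -> measurable_fun setT (fun p => g p * f (phi p)).
Proof. by move=> mf; apply: emeasurable_funM => //; exact: measurableT_comp. Qed.

Let mgfx f x : measurable_fun setT f ->
  measurable_fun setT (fun y => g (x, y) * f (phi (x, y))).
Proof. by move=> mf; exact: (measurableT_comp (mgf mf) (pair1_measurable x)). Qed.

Let mIx f : (forall z, 0 <= f z) -> measurable_fun setT f ->
  measurable_fun setT (fun x => \int[kappa x]_y (g (x, y) * f (phi (x, y)))).
Proof.
move=> f0 mf; apply: (@mkappa (fun p => g p * f (phi p))) => [p|].
  exact: mule_ge0.
exact: mgf.
Qed.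

Let I_ge0 f : (forall z, 0 <= f z) -> 0 <= I f.
Proof.
move=> f0; apply: integral_ge0 => x _; apply: integral_ge0 => y _.
exact: mule_ge0.
Qed.

Let I_series (f : nat -> Z -> \bar R) : (forall n z, 0 <= f n z) ->
  (forall n, measurable_fun setT (f n)) ->
  I (fun z => \sum_(n <oo) f n z) = \sum_(n <oo) I (f n).
Proof.
move=> f0 mf; rewrite /I -integral_nneseries//; last 2 first.
- by move=> n; exact: mIx.
- by move=> n x _; apply: integral_ge0 => y _; exact: mule_ge0.
apply: eq_integral => x _; rewrite -integral_nneseries//; last 2 first.
- by move=> n; exact: mgfx.
- by move=> n y _; exact: mule_ge0.
by apply: eq_integral => y _; rewrite mule_nneseriesr.
Qed.

Let I_lim (f : nat -> Z -> \bar R) : (forall n z, 0 <= f n z) ->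
  (forall n, measurable_fun setT (f n)) ->
  (forall z, nondecreasing_seq (f ^~ z)) ->
  I (fun z => limn (f ^~ z)) = limn (fun n => I (f n)).
Proof.
move=> f0 mf ndf; rewrite /I -monotone_convergence//; last 3 first.
- by move=> n; exact: mIx.
- by move=> n x _; apply: integral_ge0 => y _; exact: mule_ge0.
- move=> x _ m n mn; apply: ge0_le_integral => //.
  + by move=> y _; exact: mule_ge0.
  + exact: mgfx.
  + exact: mgfx.
  + by move=> y _; apply: lee_wpmul2l => //; exact: ndf.
apply: eq_integral => x _; rewrite -monotone_convergence//; last 3 first.
- by move=> n; exact: mgfx.
- by move=> n y _; exact: mule_ge0.
- by move=> y _ m n mn; apply: lee_wpmul2l => //; exact: ndf.
by apply: eq_integral => y _; rewrite mule_limn.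
Qed.

Let I_sum (J : Type) (s : seq J) (f : J -> Z -> \bar R) :
  (forall j z, 0 <= f j z) -> (forall j, measurable_fun setT (f j)) ->
  I (fun z => \sum_(j <- s) f j z) = \sum_(j <- s) I (f j).
Proof.
move=> f0 mf; rewrite /I -ge0_integral_sum//; last 2 first.
- by move=> n; exact: mIx.
- by move=> n x _; apply: integral_ge0 => y _; exact: mule_ge0.
apply: eq_integral => x _; rewrite -ge0_integral_sum//; last 2 first.
- by move=> n; exact: mgfx.
- by move=> n y _; exact: mule_ge0.
by apply: eq_integral => y _; rewrite ge0_sume_distrr.
Qed.

Let I_scale (c : R) (f : Z -> \bar R) : (0 <= c)%R ->
  (forall z, 0 <= f z) -> measurable_fun setT f ->
  I (fun z => c%:E * f z) = c%:E * I f.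
Proof.
move=> c0 f0 mf; rewrite /I -ge0_integralZl//; last 2 first.
- exact: mIx.
- by move=> x _; apply: integral_ge0 => y _; exact: mule_ge0.
apply: eq_integral => x _; rewrite -ge0_integralZl//; last 2 first.
- exact: mgfx.
- by move=> y _; exact: mule_ge0.
by apply: eq_integral => y _; rewrite muleCA.
Qed.

Let EI0 (A : set Z) z : 0 <= (\1_A z)%:E :> \bar R.
Proof. by rewrite lee_fin. Qed.

Let mEI (A : set Z) : measurable A ->
  measurable_fun setT (fun z => (\1_A z)%:E : \bar R).
Proof. by move=> mA; exact/measurable_EFinP/measurable_indic. Qed.

Lemma mixture_measure : exists m : {measure set Z -> \bar R}, forall A,
  m A = \int[mu]_x \int[kappa x]_y (g (x, y) * (\1_A (phi (x, y)))%:E).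
Proof.
pose m A := I (fun z => (\1_A z)%:E).
have m0 : m set0 = 0.
  by rewrite /m /I integral0_eq// => x _; rewrite integral0_eq// => y _;
    rewrite indic0 mule0.
have m_ge0 A : 0 <= m A by exact: I_ge0.
have m_sigma : semi_sigma_additive m.
  move=> F mF tF mUF.
  rewrite [X in _ --> X](_ : _ = \sum_(n <oo) m (F n)).
    by apply: is_cvg_nneseries => n _ _.
  rewrite /m -I_series//; last by move=> n; exact: mEI.
  by congr I; apply/funext => z; rewrite indic_bigcup.
pose H := isMeasure.Build _ _ _ m m0 m_ge0 m_sigma.
by exists (HB.pack_for {measure set Z -> \bar R} m H).
Qed.

Import HBNNSimple.

(** Both sides are linear and continuous along increasing sequences, and they
    agree on indicators; so they agree on simple functions and their limits. *)
Lemma integral_mixture (m : {measure set Z -> \bar R}) (f : Z -> \bar R) :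
  (forall A, measurable A -> m A =
    \int[mu]_x \int[kappa x]_y (g (x, y) * (\1_A (phi (x, y)))%:E)) ->
  (forall z, 0 <= f z) -> measurable_fun setT f ->
  \int[m]_z f z = \int[mu]_x \int[kappa x]_y (g (x, y) * f (phi (x, y))).
Proof.
move=> mE f0 mf; rewrite -/(I f).
pose f_ := nnsfun_approx measurableT mf.
have fE : f = fun z => limn (fun n => (f_ n z)%:E).
  by apply/funext => z; apply/esym/cvg_lim => //; exact: cvg_nnsfun_approx.
have ndf z : nondecreasing_seq (fun n => (f_ n z)%:E).
  by move=> a b ab; rewrite lee_fin; exact/lefP/nd_nnsfun_approx.
have mf_ n : measurable_fun setT (fun z => (f_ n z)%:E) by exact/measurable_EFinP.
have f_0 n z : 0 <= (f_ n z)%:E by rewrite lee_fin.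
rewrite fE monotone_convergence// I_lim//.
congr (limn _); apply/funext => n.
pose s : seq R := fset_set (range (f_ n)).
(* The maximum changes no value of the nonnegative function [f_ n]; it makes
   every coefficient of the sum nonnegative. *)
have f_E : (fun z => (f_ n z)%:E) = fun z =>
    \sum_(r <- s) (Num.max 0 r)%:E * (\1_(f_ n @^-1` [set r]) z)%:E.
  apply/funext => z; rewrite fimfunE -fsumEFin// fsbig_finite//=.
  apply: eq_big_seq => r; rewrite /s in_fset_set// inE => -[y _ <-].
  by rewrite EFinM max_r.
have r0 (r : R) : (0 <= Num.max 0 r)%R by rewrite le_max lexx.
have mr (r : R) : measurable (f_ n @^-1` [set r]) by exact: measurable_sfunP.
have mrE (r : R) : measurable_fun setT
    (fun z => (Num.max 0%R r)%:E * (\1_(f_ n @^-1` [set r]) z)%:E).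
  by apply/measurable_funeM/mEI; exact: mr.
rewrite f_E I_sum//; last by move=> r z; apply: mule_ge0; rewrite lee_fin.
rewrite ge0_integral_sum//; last by move=> r z _; apply: mule_ge0; rewrite lee_fin.
have cr0 (r : R) : 0 <= (Num.max 0 r)%:E by rewrite lee_fin.
apply: eq_bigr => r _; rewrite I_scale//; last exact: (mEI (mr r)).
rewrite ge0_integralZl//; last exact: (mEI (mr r)).
by rewrite integral_indic// setIT mE.
Qed.

End mixture.

(** * Locally finite measures as a measurable family *)

Section lfmeasure_kernel.
Local Open Scope ereal_scope.
Variables (G : topologicalZmodType) (R : realType).
Hypothesis hG : lcsc_group G.
Local Notation M := (lfmeasure G R).

(** Equality on all sets, not only on the Borel sets, is needed here, since a
    measure is a function on all sets. *)
Lemma lfmeasure_ext (xi eta : M) :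
  (forall A : set (borel G), xi A = eta A) -> xi = eta.
Proof.
case: xi eta => [m mK] [n nK] /= mn.
have : m = n by apply: eq_measure; exact/funext.
by move=> mnE; subst n; congr LFMeasure; exact: Prop_irrelevance.
Qed.

Lemma sigma_finite_lf (xi : M) : sigma_finite setT xi.
Proof.
have [C cC CT] := compact_cover hG.
by exists C => // n; split; [exact: compact_measurable|exact: lf_compact].
Qed.

Lemma relatively_compact_partition : exists D : nat -> set (borel G),
  [/\ forall n, measurable (D n), trivIset setT D, \bigcup_n D n = setT &
      forall n, exists2 K : set G, compact K & D n `<=` K].
Proof.
have [C cC CT] := compact_cover hG.
have mC n : measurable (C n : set (borel G)) by exact: compact_measurable.
exists (seqDU (C : nat -> set (borel G))); split => [n|||n].
- by apply: measurableD => //; exact: bigsetU_measurable.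
- exact: trivIset_seqDU.
- by rewrite -seqDU_bigcup_eq.
- by exists (C n) => //; exact: subDsetl.
Qed.

Lemma measurable_lfmeasure d (X : measurableType d) (phi : X -> M) :
  (forall K : set G, compact K -> measurable_fun setT (fun x => phi x K)) ->
  measurable_fun setT phi.
Proof.
move=> mphi; apply: (@measurability _ _ _ _ _ _ (@lfmeasure_gen G R)) => //.
move=> _ [_ [K cK [B mB <-]] <-].
by rewrite !setTI; have := mphi K cK measurableT B mB; rewrite setTI.
Qed.

Lemma measurable_lf_compact (K : set G) : compact K ->
  measurable_fun setT (fun xi : M => xi K).
Proof.
move=> cK _ B mB; apply: sub_sigma_algebra; exists K => //.
by exists B.
Qed.

(** For [A] inside a compact set [K] this is a monotone class argument from the
    compact sets, in which [xi K < +oo] allows differences; a general [A] is a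
    countable disjoint union of such sets. *)
Lemma measurable_lf_eval (A : set (borel G)) : measurable A ->
  measurable_fun setT (fun xi : M => xi A).
Proof.
move=> mA; have [D [mD tD DT DK]] := relatively_compact_partition.
rewrite (_ : (fun xi : M => xi A) = fun xi => \sum_(n <oo) xi (A `&` D n)).
  apply: ge0_emeasurable_sum => // n _.
  have [K cK DnK] := DK n.
  have mK : measurable (K : set (borel G)) by exact: compact_measurable.
  pose H := [set B : set (borel G) | measurable B /\
    measurable_fun setT (fun xi : M => xi (B `&` K))].
  suff HE : measurable `<=` H.
    rewrite (_ : A `&` D n = A `&` D n `&` K).
      by have [] := HE _ (measurableI _ _ mA (mD n)).
    by rewrite -setIA (setIidl DnK).
  rewrite (borel_generated_by_compact hG); apply: lambda_system_subset.
  - exact: (compact_setI_closed hG).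
  - split => //.
    + by split => //; rewrite setTI; exact: measurable_lf_compact.
    + move=> B B' B'B [mB mBK] [mB' mB'K]; split; first exact: measurableD.
      rewrite (_ : (fun _ => _) = (fun xi : M => xi (B `&` K) - xi (B' `&` K))).
        exact: emeasurable_funB.
      apply/funext => xi.
      rewrite (_ : (B `\` B') `&` K = (B `&` K) `\` (B' `&` K)); last first.
        apply/seteqP; split => [x [[Bx B'x] Kx]|x [[Bx Kx] B'Kx]].
          by split => // -[].
        by split => //; split => // B'x; apply: B'Kx.
      rewrite measureD//; last 3 first.
      * exact: measurableI.
      * exact: measurableI.
      * rewrite (@le_lt_trans _ _ (xi K))//; last exact: lf_compact.
        by rewrite le_measure ?inE//; exact: measurableI.
      by rewrite (@setIidr _ (B `&` K) (B' `&` K))//; exact: setSI.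
    + move=> F ndF HF.
      have mF i : measurable (F i) by have [] := HF i.
      split; first exact: bigcup_measurable.
      apply: (@emeasurable_fun_cvg _ _ _ _ (fun i (xi : M) => xi (F i `&` K))).
        by move=> i; have [] := HF i.
      move=> xi _; rewrite setI_bigcupl; apply: nondecreasing_cvg_mu.
      * by move=> i; exact: measurableI.
      * by apply: bigcup_measurable => i _; exact: measurableI.
      * move=> i j ij; apply/subsetPset; apply: setSI.
        by apply/subsetPset; exact: ndF.
  - move=> L cL; split; first exact: compact_measurable.
    by apply: measurable_lf_compact; exact: (compact_setI_closed hG).
  - by move=> ? _ ? _.
apply/funext => xi.
rewrite -[in LHS](setIT A) -DT setI_bigcupr measure_bigcup//.
- by apply: eq_eseriesl => i; rewrite in_setT.
- by move=> i _; exact: measurableI.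
- exact: trivIset_setIl.
Qed.

Definition lf_kernel d (X : measurableType d) (phi : X -> M)
  (mphi : measurable_fun setT phi) (x : X) : {measure set (borel G) -> \bar R} :=
  phi x.

Lemma measurable_lf_kernel d (X : measurableType d) (phi : X -> M)
    (mphi : measurable_fun setT phi) (A : set (borel G)) : measurable A ->
  measurable_fun setT (lf_kernel mphi ^~ A).
Proof.
by move=> mA; apply: (measurableT_comp (measurable_lf_eval mA)).
Qed.

HB.instance Definition _ d (X : measurableType d) (phi : X -> M)
    (mphi : measurable_fun setT phi) :=
  isKernel.Build _ _ _ _ R (lf_kernel mphi) (measurable_lf_kernel mphi).

Import HBNNSimple.

(** By monotone approximation it is enough to measure the sections of a
    measurable set.  On a piece of a relatively compact partition each [phi x]
    is finite, though not uniformly in [x], and the sections are measured there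
    by a monotone class argument; their values are then summed. *)
Lemma measurable_integral_lf d (X : measurableType d) (phi : X -> M)
    (f : X * borel G -> \bar R) : measurable_fun setT phi ->
  (forall p, 0 <= f p) -> measurable_fun setT f ->
  measurable_fun setT (fun x => \int[phi x]_t f (x, t)).
Proof.
move=> mphi f0 mf.
pose f_ := nnsfun_approx measurableT mf.
apply: (@measurable_fun_xsection_integral _ _ _ _ _ _ (lf_kernel mphi) f_).
- by move=> a b ab; exact/nd_nnsfun_approx.
- by move=> z; exact/cvg_nnsfun_approx.
move=> n r.
have mA : measurable (f_ n @^-1` [set r]) by exact: measurable_sfunP.
set A := _ @^-1` _ in mA *.
have [D [mD tD DT DK]] := relatively_compact_partition.
rewrite (_ : (fun x => _) = fun x =>
    \sum_(i <oo) mrestr (lf_kernel mphi x) (mD i) (xsection A x)).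
  apply: ge0_emeasurable_sum => // i _.
  suff kD x : exists r0 : R, forall B, measurable B ->
      mrestr (lf_kernel mphi x) (mD i) B < r0%:E.
    exact: (measurable_prod_subset_xsection_kernel kD mA).2.
  have [K cK DiK] := DK i.
  have Kfin : phi x K \is a fin_num by rewrite ge0_fin_numE//; exact: lf_compact.
  exists (fine (phi x K) + 1)%R => B mB.
  rewrite (@le_lt_trans _ _ (phi x K))//.
    apply: le_measure; rewrite ?inE//; first exact: measurableI.
      exact: compact_measurable.
    by apply: subset_trans DiK; exact: subIsetr.
  by rewrite -[X in X < _](fineK Kfin) lte_fin ltrDl.
apply/funext => x; rewrite /mrestr.
have mAx := measurable_xsection x mA.
rewrite -[in LHS](setIT (xsection A x)) -DT setI_bigcupr measure_bigcup//.
- by apply: eq_eseriesl => i; rewrite in_setT.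
- by move=> i _; exact: measurableI.
- exact: trivIset_setIl.
Qed.

End lfmeasure_kernel.

(** * Translations and displacements of configurations *)

Section shifts.
Local Open Scope ereal_scope.
Variables (G : topologicalZmodType) (R : realType).
Hypothesis hG : lcsc_group G.
Local Notation M := (lfmeasure G R).
Local Notation F := (displacement G R).

Lemma measurable_indicE d (X : measurableType d) d' (Y : measurableType d')
    (A : set Y) (f : X -> Y) : measurable A -> measurable_fun setT f ->
  measurable_fun setT (fun x => (\1_A (f x))%:E : \bar R).
Proof.
move=> mA mf; apply/measurable_EFinP.
by apply: (measurableT_comp (measurable_indic mA) mf).
Qed.

Lemma integral_tau (t : G) (xi : M) (f : borel G -> \bar R) :
  (forall s, 0 <= f s) -> measurable_fun setT f ->
  \int[tau t xi]_s f s = \int[xi]_s f (s - t)%R.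
Proof.
move=> f0 mf; apply: (integral_image (phi := fun s : borel G => (s - t)%R)) => //.
exact: (continuous_borel_measurable (@translation_continuous G (- t)%R)).
Qed.

Lemma integral_Gamma (xi : M) (B : F) (f : borel G -> \bar R) :
  (forall s, 0 <= f s) -> measurable_fun setT f ->
  \int[Gamma (xi, B)]_s f s = \int[xi]_s f (s + B s)%R.
Proof.
move=> f0 mf; apply: (integral_image (phi := fun s : borel G => (s + B s)%R)) => //.
exact: (continuous_borel_measurable
  (displacement_continuous (@disp_continuous _ _ B))).
Qed.

Lemma tau_tau (s t : G) (xi : M) : tau s (tau t xi) = tau (t + s)%R xi.
Proof.
apply: lfmeasure_ext => A.
change (xi ((fun x => x - t - s)%R @^-1` A) = xi ((fun x => x - (t + s))%R @^-1` A)).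
by congr (xi (_ @^-1` A)); apply/funext => x /=; rewrite opprD addrA.
Qed.

Lemma tau0 (xi : M) : tau 0%R xi = xi.
Proof.
apply: lfmeasure_ext => A; rewrite /= /pushforward.
by rewrite (_ : (fun s => _) = id)//; apply/funext => x /=; rewrite oppr0 addr0.
Qed.

(** The re-centred field [theta t B] records displacements relative to that of
    [t].  Hence a change of viewpoint to a displaced point acts separately on
    the configuration and on the field. *)
Lemma tau_Gamma (t : G) (xi : M) (B : F) :
  tau (t + B t)%R (Gamma (xi, B)) = Gamma (tau t xi, theta t B).
Proof.
apply: lfmeasure_ext => A.
change (xi ((fun x => x + B x - (t + B t))%R @^-1` A) =
        xi ((fun x => (x - t) + (B (t + (x - t)) - B t))%R @^-1` A)).
congr (xi (_ @^-1` A)); apply/funext => x /=.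
by rewrite opprD addrACA [(t + (x - t))%R]addrC subrK.
Qed.

Section measurability.
Context d (X : measurableType d).
Variables (xi : X -> M) (B : X -> F) (t : X -> borel G).
Hypotheses (mxi : measurable_fun setT xi) (mB : measurable_fun setT B).
Hypothesis mt : measurable_fun setT t.

Lemma measurable_tau : measurable_fun setT (fun x => @tau G R (t x) (xi x)).
Proof.
apply: measurable_lfmeasure => K cK.
have mK : measurable (K : set (borel G)) by exact: compact_measurable.
have mtK x : measurable ((fun s : borel G => (s - t x)%R) @^-1` K).
  have mf := continuous_borel_measurable (@translation_continuous G (- t x)%R).
  by have := mf measurableT K mK; rewrite setTI.
rewrite (_ : (fun x => _) = fun x => \int[xi x]_s (\1_K (s - t x)%R)%:E); last first.
  apply/funext => x; rewrite integral_indic//; last exact: mtK.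
  by rewrite setIT.
apply: (measurable_integral_lf hG (f := fun p => (\1_K (p.2 - t p.1)%R)%:E)) => //.
apply: measurable_indicE => //; apply: (measurable_subG hG) => //.
exact: measurableT_comp.
Qed.

Lemma measurable_disp_eval : measurable_fun setT (fun x => (B x) (t x) : borel G).
Proof.
apply: (@measurableT_comp _ _ _ _ _ _
  (fun p : F * borel G => p.1 p.2 : borel G) _ (fun x => (B x, t x))); last first.
  exact: measurable_fun_pair.
apply: (measurable_caratheodory hG (b := fun (b : F) (r : G) => b r)).
  move=> r _ A mA; apply: sub_sigma_algebra; exists r => //.
  by exists A.
exact: disp_continuous.
Qed.

Lemma measurable_displacement (phi : X -> F) :
  (forall r : G, measurable_fun setT (fun x => phi x r : borel G)) ->
  measurable_fun setT phi.
Proof.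
move=> mphi; apply: (@measurability _ _ _ _ _ _ (@displacement_gen G R)) => //.
move=> _ [_ [r _ [A mA <-]] <-].
by rewrite !setTI; have := mphi r measurableT A mA; rewrite setTI.
Qed.

End measurability.

Lemma measurable_theta d (X : measurableType d) (B : X -> F) (t : X -> borel G) :
  measurable_fun setT B -> measurable_fun setT t ->
  measurable_fun setT (fun x => @theta G R (t x) (B x)).
Proof.
move=> mB mt; apply: measurable_displacement => r /=.
apply: (measurable_subG hG); apply: measurable_disp_eval => //.
exact: (measurable_addG hG).
Qed.

Lemma measurable_Gamma d (X : measurableType d) (xi : X -> M) (B : X -> F) :
  measurable_fun setT xi -> measurable_fun setT B ->
  measurable_fun setT (fun x => Gamma (xi x, B x)).
Proof.
move=> mxi mB; apply: measurable_lfmeasure => K cK.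
have mK : measurable (K : set (borel G)) by exact: compact_measurable.
have mBK x : measurable ((fun s : borel G => (s + B x s)%R) @^-1` K).
  have mf := continuous_borel_measurable
    (displacement_continuous (@disp_continuous _ _ (B x))).
  by have := mf measurableT K mK; rewrite setTI.
rewrite (_ : (fun x => _) =
    fun x => \int[xi x]_s (\1_K (s + B x s)%R)%:E); last first.
  apply/funext => x; rewrite integral_indic//; last exact: mBK.
  by rewrite setIT.
apply: (measurable_integral_lf hG
  (f := fun p => (\1_K (p.2 + B p.1 p.2)%R)%:E)) => //.
apply: measurable_indicE => //; apply: (measurable_addG hG) => //.
apply: measurable_disp_eval => //.
exact: measurableT_comp.
Qed.

Lemma null_lfmeasureE (xi : M) : null_lfmeasure xi <-> xi setT = 0.
Proof.
split => [|xi0 A mA]; first exact.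
apply/eqP; rewrite eq_le measure_ge0 andbT -xi0.
by apply: le_measure; rewrite ?inE.
Qed.

Lemma measurable_null_lfmeasure : measurable (@null_lfmeasure G R).
Proof.
rewrite (_ : @null_lfmeasure G R = (fun xi : M => xi setT) @^-1` [set 0]).
  rewrite -[X in measurable X]setTI.
  by apply: (measurable_lf_eval hG).
by apply/seteqP; split => xi /null_lfmeasureE.
Qed.

Lemma null_tau (t : G) (xi : M) : null_lfmeasure (tau t xi) <-> null_lfmeasure xi.
Proof. by rewrite !null_lfmeasureE /= /pushforward preimage_setT. Qed.

Lemma null_Gamma (xi : M) (B : F) :
  null_lfmeasure (Gamma (xi, B)) <-> null_lfmeasure xi.
Proof. by rewrite !null_lfmeasureE /= /pushforward preimage_setT. Qed.

Lemma nonnull_cover (C : nat -> set (borel G)) (xi : M) :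
  (forall n, measurable (C n)) -> \bigcup_n C n = setT -> ~ null_lfmeasure xi ->
  exists n, xi (C n) != 0.
Proof.
move=> mC CT; apply: contra_notP => /forallNP C0; apply/null_lfmeasureE.
by rewrite -CT measure_bigcup_eq0// => n; apply/eqP/negPn/negP/C0.
Qed.

Lemma finite_cover : exists C : nat -> set (borel G),
  [/\ forall n, measurable (C n), forall n (xi : M), xi (C n) < +oo &
      \bigcup_n C n = setT].
Proof.
have [C cC CT] := compact_cover hG.
exists (C : nat -> set (borel G)); split => // [n|n xi].
  exact: compact_measurable.
exact: lf_compact.
Qed.

Lemma integral_null (xi : M) (f : borel G -> \bar R) : null_lfmeasure xi ->
  measurable_fun setT f -> \int[xi]_s f s = 0.
Proof. by move=> /null_lfmeasureE xi0 mf; exact: null_set_integral. Qed.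

End shifts.

(** * Measurability and nonnegativity by structural recursion *)

Ltac nonnegativity := repeat match goal with
  | |- forall _, _ => move=> ?
  | |- is_true (_ <= integral _ _ _)%E => apply: integral_ge0
  | |- is_true (_ <= _ * _)%E => apply: mule_ge0
  | |- is_true (_ <= _%:E)%E => rewrite lee_fin
  | |- _ => done
  end.

(** One step follows the head symbol of the function; [hG] provides the joint
    measurability of the group operations, translations and displacements.  An
    integrand with parameter [x] and variable [t] is turned into a function of
    the pair [(x, t)]. *)
Ltac measurability_step hG :=
  cbn [fst snd];
  match goal with
  | |- measurable_fun _ (fun x => x) => exact: measurable_id
  | |- measurable_fun _ (fun x => ?c) => exact: measurable_cst
  | |- measurable_fun _ (fun x => (@?a x).1) =>
      apply: (@measurableT_comp _ _ _ _ _ _ fst _ a measurable_fst)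
  | |- measurable_fun _ (fun x => (@?a x).2) =>
      apply: (@measurableT_comp _ _ _ _ _ _ snd _ a measurable_snd)
  | |- measurable_fun _ (fun x => (@?a x, @?b x)) =>
      apply: (@measurable_fun_pair _ _ _ _ _ _ a b)
  | |- measurable_fun _ (fun x => @tau _ _ (@?t x) (@?xi x)) =>
      apply: (measurable_tau hG (xi := xi) (t := t))
  | |- measurable_fun _ (@tau _ _ ?t) =>
      apply: (measurable_tau hG (xi := fun x => x) (t := fun=> t))
  | |- measurable_fun _ (@theta _ _ ?t) =>
      apply: (measurable_theta hG (B := fun x => x) (t := fun=> t))
  | |- measurable_fun _ (fun x => @theta _ _ (@?t x) (@?B x)) =>
      apply: (measurable_theta hG (B := B) (t := t))
  | |- measurable_fun _ (fun x => Gamma (@?xi x, @?B x)) =>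
      apply: (measurable_Gamma hG (xi := xi) (B := B))
  | |- measurable_fun _ (fun x => disp_fun (@?B x) (@?t x)) =>
      apply: (measurable_disp_eval hG (B := B) (t := t))
  | |- measurable_fun _ (fun x => (@?s x + @?t x)%R) =>
      apply: (measurable_addG hG (s := s) (t := t))
  | |- measurable_fun _ (fun x => (- @?s x)%R) =>
      apply: (measurable_oppG (s := s))
  | |- measurable_fun _ (fun x => (@?f x * @?g x)%E) =>
      apply: (emeasurable_funM (f := f) (g := g))
  | |- measurable_fun _ (fun x =>
      @integral _ _ _ (Measure.sort (lf_measure (@?xi x))) _ (fun t => @?f x t)) =>
      apply: (measurable_integral_lf hG (phi := xi) (f := fun p => f p.1 p.2))
  | |- measurable_fun _ (fun x => @integral _ _ _ ?m _ (fun t => @?f x t)) =>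
      apply: (measurable_integral_sigma_finite (f := fun p => f p.1 p.2))
  | |- measurable_fun _ (fun x => (\1_?A (@?f x))%:E) =>
      apply: (@measurable_indicE _ _ _ _ _ A f)
  | |- measurable_fun _ (fun x => (@?f x)%:E) => apply/measurable_EFinP
  | H : measurable_fun _ ?f |- measurable_fun _ (fun x => ?f (@?a x)) =>
      apply: (@measurableT_comp _ _ _ _ _ _ f _ a H)
  | |- forall _, _ => solve [nonnegativity]
  | |- _ => done
  end.

Ltac measurability_of hG := repeat measurability_step hG.

(** * Palm measures, Campbell's and Mecke's identities *)

Section palm.
Local Open Scope ereal_scope.
Variables (G : topologicalZmodType) (R : realType).
Hypothesis hG : lcsc_group G.
Local Notation M := (lfmeasure G R).
Variable lambda : M.
Hypothesis lambda_haar : haar_measure lambda.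

(** The refined Campbell identity: under [P], a point of the configuration and
    the configuration seen from it have the product [P0 x lambda] as their
    joint distribution. *)
Definition campbell (P P0 : set M -> \bar R) :=
  forall f : M * borel G -> \bar R, (forall p, 0 <= f p) -> measurable_fun setT f ->
  \int[P]_xi \int[xi]_t f (@tau G R t xi, t) = \int[P0]_xi \int[lambda]_t f (xi, t).

(** Mecke's exchange identity: the origin and the point [t] of [xi] play
    symmetric roles; seen from [t], the origin is the point [- t]. *)
Definition mecke (Q : set M -> \bar R) :=
  forall h : M * borel G -> \bar R, (forall p, 0 <= h p) -> measurable_fun setT h ->
  \int[Q]_xi \int[xi]_t h (@tau G R t xi, (- t)%R) = \int[Q]_xi \int[xi]_t h (xi, t).

Lemma haar_shift (t : G) (f : borel G -> \bar R) :
  (forall s, 0 <= f s) -> measurable_fun setT f ->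
  \int[lambda]_s f (s + t)%R = \int[lambda]_s f s.
Proof.
move=> f0 mf; rewrite -[t]opprK -integral_tau//.
by apply: eq_measure_integral => A mA _; exact: lambda_haar.2.
Qed.

(** The normalised indicator of [C] united with [- C], for a compact [C] of
    positive measure.  The symmetry stands in for the invariance of [lambda]
    under [t |-> - t]. *)
Lemma symmetric_density : exists omega : borel G -> R,
  [/\ measurable_fun setT omega, forall t, (0 <= omega t)%R,
      forall t, omega (- t)%R = omega t & \int[lambda]_t (omega t)%:E = 1].
Proof.
have [[A mA lA] _] := lambda_haar.
have [C cC CT] := compact_cover hG.
have mC n : measurable (C n : set (borel G)) by exact: compact_measurable.
have lambdaN : ~ null_lfmeasure lambda.
  by move=> /(_ A mA) lA0; rewrite lA0 eqxx in lA.
have [n Cn0] := nonnull_cover mC CT lambdaN.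
pose K : set (borel G) := C n `|` (fun t : G => - t)%R @^-1` (C n).
have cK : compact (K : set G).
  apply: compactU => //.
  rewrite (_ : _ @^-1` _ = (fun t : G => - t)%R @` C n).
    apply: continuous_compact => //; apply: continuous_subspaceT.
    exact: opp_continuous.
  apply/seteqP; split => [t Ct|_ [t Ct <-]] /=; last by rewrite opprK.
  by exists (- t)%R => //; rewrite opprK.
have mK : measurable K by exact: compact_measurable.
have lKfin : lambda K \is a fin_num by rewrite ge0_fin_numE//; exact: lf_compact.
have lK : (0 < fine (lambda K))%R.
  rewrite fine_gt0// -ge0_fin_numE// lKfin andbT.
  rewrite (@lt_le_trans _ _ (lambda (C n)))// ?lt0e ?Cn0//=.
  by apply: le_measure; rewrite ?inE//; exact: subsetUl.
exists (fun t => (fine (lambda K))^-1 * \1_K t)%R; split => [||t|].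
- by apply: measurable_funM => //; exact: measurable_indic.
- by move=> t; rewrite mulr_ge0// invr_ge0 ltW.
- congr (_ * _)%R; rewrite !indicE; congr ((_ : bool)%:R).
  by apply/idP/idP; rewrite !inE /K /= ?opprK => -[]; [right|left|right|left].
- under eq_integral do rewrite EFinM.
  have l0 : 0 <= ((fine (lambda K))^-1)%:E by rewrite lee_fin invr_ge0 ltW.
  rewrite ge0_integralZl//; last first.
    by apply/measurable_EFinP; exact: measurable_indic.
  rewrite integral_indic// setIT -[X in _ * X]fineK// -EFinM mulVf//.
  by rewrite gt_eqF.
Qed.

End palm.

Section palm_theory.
Local Open Scope ereal_scope.
Variables (G : topologicalZmodType) (R : realType).
Hypothesis hG : lcsc_group G.
Local Notation M := (lfmeasure G R).
Variable lambda : M.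
Hypothesis lambda_haar : haar_measure lambda.

Lemma integral_palm_measure (P P0 : {measure set M -> \bar R}) (omega : borel G -> R)
    (g : M -> \bar R) :
  is_palm_measure lambda P P0 ->
  measurable_fun setT omega -> (forall t, (0 <= omega t)%R) ->
  \int[lambda]_t (omega t)%:E = 1 ->
  (forall xi, 0 <= g xi) -> measurable_fun setT g ->
  \int[P0]_xi g xi = \int[P]_xi \int[xi]_t ((omega t)%:E * g (@tau G R t xi)).
Proof.
move=> palm momega omega0 omega1 g0 mg.
apply: (@integral_mixture _ _ _ _ _ _ _ P (fun xi : M => lf_measure xi) _
  (fun p : M * borel G => (omega p.2)%:E) (fun p => @tau G R p.2 p.1)) => //=.
- by move=> f f0 mf; measurability_of hG.
- by nonnegativity.
- by measurability_of hG.
- by measurability_of hG.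
- by move=> A mA; rewrite (palm omega).
Qed.

Lemma integral_rotate (P : {measure set M -> \bar R})
    (h : borel G * M * borel G -> \bar R) : sigma_finite setT P ->
  (forall p, 0 <= h p) -> measurable_fun setT h ->
  \int[lambda]_u \int[P]_xi \int[xi]_t h (u, xi, t) =
  \int[P]_xi \int[xi]_t \int[lambda]_u h (u, xi, t).
Proof.
move=> sP h0 mh.
rewrite (tonelli (f := fun p : borel G * M =>
  \int[p.2]_t h (p.1, p.2, t)))//=; last 3 first.
- exact: sigma_finite_lf.
- by nonnegativity.
- by measurability_of hG.
apply: eq_integral => xi _.
rewrite (tonelli (f := fun p : borel G * borel G => h (p.1, xi, p.2)))//=.
- exact: sigma_finite_lf.
- exact: sigma_finite_lf.
- by measurability_of hG.
Qed.

(** By stationarity [int P(dxi) int xi(dt) f(tau t xi, t + u)] does not depend on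
    [u].  Average it over [u] against the symmetric density [omega] and
    substitute [v = t + u]: for each fixed [v] the weight [omega (t - v)] is an
    admissible density in the definition of the Palm measure. *)
Lemma palm_campbell (P P0 : {measure set M -> \bar R}) :
  sigma_finite setT P -> sigma_finite setT P0 -> stationary P ->
  is_palm_measure lambda P P0 -> campbell lambda P P0.
Proof.
move=> sP sP0 [statP _] palm f f0 mf.
have [omega [momega omega0 omegaN omega1]] := symmetric_density hG lambda_haar.
set I := LHS.
have IE u : I = \int[P]_xi \int[xi]_t f (@tau G R t xi, (t + u)%R).
  rewrite /I (integral_image (m := P) (n := P) (phi := @tau G R (- u)%R)
    (f := fun xi : M => \int[xi]_t f (@tau G R t xi, t))); last 4 first.
  - by measurability_of hG.
  - by move=> A mA; rewrite -[LHS](statP (- u)%R A mA).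
  - by nonnegativity.
  - by measurability_of hG.
  apply: eq_integral => xi _; rewrite integral_tau; last 2 first.
  - by nonnegativity.
  - by measurability_of hG.
  apply: eq_integral => t _; rewrite opprK tau_tau.
  by rewrite addrC addrK.
have I0 : 0 <= I by rewrite /I; nonnegativity.
transitivity (\int[lambda]_u \int[P]_xi \int[xi]_t
    ((omega u)%:E * f (@tau G R t xi, (t + u)%R))).
  rewrite -[LHS]mul1e -omega1 -ge0_integralZr//; last 2 first.
  - by measurability_of hG.
  - by move=> t _; rewrite lee_fin.
  apply: eq_integral => u _; rewrite (IE u) -ge0_integralZl//; last 3 first.
  - by measurability_of hG.
  - by nonnegativity.
  - by rewrite lee_fin.
  apply: eq_integral => xi _; rewrite -ge0_integralZl//; last 2 first.
  - by measurability_of hG.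
  - by rewrite lee_fin.
rewrite (integral_rotate (h := fun q => (omega q.1.1)%:E *
  f (@tau G R q.2 q.1.2, (q.2 + q.1.1)%R)))//=; last 2 first.
- by nonnegativity.
- by measurability_of hG.
transitivity (\int[P]_xi \int[xi]_t \int[lambda]_v
    ((omega (t - v)%R)%:E * f (@tau G R t xi, v))).
  apply: eq_integral => xi _; apply: eq_integral => t _.
  rewrite -[RHS](haar_shift lambda_haar t); last 2 first.
  - by nonnegativity.
  - by measurability_of hG.
  apply: eq_integral => u _.
  by rewrite [(u + t)%R]addrC opprD addrA subrr add0r omegaN.
rewrite -(integral_rotate (h := fun q => (omega (q.2 - q.1.1)%R)%:E *
  f (@tau G R q.2 q.1.2, q.1.1)))//=; last 2 first.
- by nonnegativity.
- by measurability_of hG.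
rewrite [RHS](tonelli (f := f))//; last exact: sigma_finite_lf.
apply: eq_integral => v _; apply/esym.
apply: (integral_palm_measure (omega := fun t => omega (t - v)%R)
  (g := fun xi => f (xi, v))) => //.
- by measurability_of hG.
- rewrite (haar_shift lambda_haar (- v)%R (f := fun t => (omega t)%:E))//.
  by measurability_of hG.
- by measurability_of hG.
Qed.

(** Spread the left side of Mecke's identity over [P] with a density [omega]: a
    double integral over pairs [(s, t)] of points of [xi] appears.  Exchange
    [s] and [t], and return to [P0] from the point [t]. *)
Lemma campbell_mecke (P P0 : {measure set M -> \bar R}) :
  campbell lambda P P0 -> mecke P0.
Proof.
move=> camp h h0 mh.
have [omega [momega omega0 _ omega1]] := symmetric_density hG lambda_haar.
transitivity (\int[P0]_xi \int[lambda]_u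
    ((omega u)%:E * \int[xi]_t h (@tau G R t xi, (- t)%R))).
  apply: eq_integral => xi _; rewrite ge0_integralZr//; last 3 first.
  - by measurability_of hG.
  - by move=> t _; rewrite lee_fin.
  - by nonnegativity.
  by rewrite omega1 mul1e.
rewrite -(camp (fun q : M * borel G => (omega q.2)%:E *
  \int[q.1]_t h (@tau G R t q.1, (- t)%R)))/=; last 2 first.
- by nonnegativity.
- by measurability_of hG.
transitivity (\int[P]_xi \int[xi]_s \int[xi]_t
    ((omega s)%:E * h (@tau G R t xi, (s - t)%R))).
  apply: eq_integral => xi _; apply: eq_integral => s _.
  rewrite integral_tau; last 2 first.
  - by nonnegativity.
  - by measurability_of hG.
  rewrite -ge0_integralZl//; last 2 first.
  - by measurability_of hG.
  - by rewrite lee_fin.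
  apply: eq_integral => t _.
  by rewrite tau_tau opprB addrCA subrr addr0.
transitivity (\int[P]_xi \int[xi]_t \int[@tau G R t xi]_s
    ((omega (s + t)%R)%:E * h (@tau G R t xi, s))).
  apply: eq_integral => xi _.
  rewrite (tonelli (f := fun q : borel G * borel G => (omega q.1)%:E *
      h (@tau G R q.2 xi, (q.1 - q.2)%R)))//=; last 4 first.
  - exact: sigma_finite_lf.
  - exact: sigma_finite_lf.
  - by nonnegativity.
  - by measurability_of hG.
  apply: eq_integral => t _; rewrite integral_tau; last 2 first.
  - by nonnegativity.
  - by measurability_of hG.
  by apply: eq_integral => s _; rewrite subrK.
rewrite (camp (fun q : M * borel G =>
  \int[q.1]_s ((omega (s + q.2)%R)%:E * h (q.1, s))))/=; last 2 first.
- by nonnegativity.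
- by measurability_of hG.
apply: eq_integral => xi _.
rewrite (tonelli (f := fun q : borel G * borel G =>
  (omega (q.2 + q.1)%R)%:E * h (xi, q.2)))//=; last 4 first.
- exact: sigma_finite_lf.
- exact: sigma_finite_lf.
- by nonnegativity.
- by measurability_of hG.
apply: eq_integral => s _.
rewrite ge0_integralZr//; last 2 first.
- by measurability_of hG.
- by move=> t _; rewrite lee_fin.
under eq_integral do rewrite addrC.
rewrite (haar_shift lambda_haar s (f := fun t => (omega t)%:E)) ?omega1 ?mul1e//.
by measurability_of hG.
Qed.

End palm_theory.

(** * Mecke's identity for the displaced configuration *)

Section displaced.
Local Open Scope ereal_scope.
Variables (G : topologicalZmodType) (R : realType).
Hypothesis hG : lcsc_group G.
Local Notation M := (lfmeasure G R).
Local Notation F := (displacement G R).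

(** Seen from the displaced point [t + B t], the configuration is the displacement
    of [tau t xi] by [theta t B], and the origin is the image of [- t].  Weak
    stationarity replaces [theta t B] by [B] for fixed [xi] and [t]; what remains
    is Mecke's identity for [P0]. *)
Lemma mecke_displaced (P0 Q : {measure set M -> \bar R})
    (nu : {measure set F -> \bar R}) :
  sigma_finite setT P0 -> sigma_finite setT nu -> weakly_stationary nu ->
  (forall g : M -> \bar R, (forall xi, 0 <= g xi) -> measurable_fun setT g ->
    \int[Q]_eta g eta = \int[P0]_xi \int[nu]_B g (Gamma (xi, B))) ->
  mecke P0 -> mecke Q.
Proof.
move=> sP0 snu wnu QE meckeP0 h h0 mh.
rewrite !QE; last 4 first.
- by nonnegativity.
- by measurability_of hG.
- by nonnegativity.
- by measurability_of hG.
transitivity (\int[P0]_xi \int[xi]_t \int[nu]_B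
    h (Gamma (@tau G R t xi, B), (- t + B (- t))%R)).
  apply: eq_integral => xi _.
  transitivity (\int[nu]_B \int[xi]_t
      h (Gamma (@tau G R t xi, @theta G R t B), (- t + (@theta G R t B) (- t))%R)).
    apply: eq_integral => B _; rewrite integral_Gamma; last 2 first.
    - by nonnegativity.
    - by measurability_of hG.
    apply: eq_integral => t _; congr h.
    by rewrite tau_Gamma /= subrr disp0 sub0r opprD.
  rewrite (tonelli (f := fun q : F * borel G =>
    h (Gamma (@tau G R q.2 xi, @theta G R q.2 q.1),
       (- q.2 + (@theta G R q.2 q.1) (- q.2))%R)))//=; last 2 first.
  - exact: sigma_finite_lf.
  - by measurability_of hG.
  apply: eq_integral => t _.
  rewrite -(integral_image (m := nu) (n := nu) (phi := @theta G R t)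
    (f := fun B => h (Gamma (@tau G R t xi, B), (- t + B (- t))%R)))//.
  - by measurability_of hG.
  - by move=> A mA; rewrite -[LHS](wnu t A mA).
  - by measurability_of hG.
rewrite (meckeP0 (fun q : M * borel G =>
    \int[nu]_B h (Gamma (q.1, B), (q.2 + B q.2)%R)))/=; last 2 first.
- by nonnegativity.
- by measurability_of hG.
apply: eq_integral => xi _.
rewrite -(tonelli (f := fun q : F * borel G =>
  h (Gamma (xi, q.1), (q.2 + q.1 q.2)%R)))//=; last 2 first.
- exact: sigma_finite_lf.
- by measurability_of hG.
apply: eq_integral => B _; rewrite integral_Gamma//.
by measurability_of hG.
Qed.

End displaced.

(** * Inversion: from Mecke's identity to a stationary measure *)

Section inversion.
Local Open Scope ereal_scope.
Variables (G : topologicalZmodType) (R : realType).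
Hypothesis hG : lcsc_group G.
Local Notation M := (lfmeasure G R).

Definition normalizing (k : M * borel G -> \bar R) := [/\ forall p, 0 <= k p,
  measurable_fun setT k &
  forall xi, ~ null_lfmeasure xi -> \int[xi]_t k (xi, t) = 1].

(** Cover the group by countably many sets [C n] of finite measure, and
    distribute the unit mass of [k] evenly over the first [C n] that [xi]
    charges. *)
Lemma exists_normalizing : exists k, normalizing k.
Proof.
have [C [mC Cfin CT]] := finite_cover R hG.
have mxiC n : measurable_fun setT (fun xi : M => xi (C n)).
  exact: measurable_lf_eval.
pose B n : set M := [set xi | xi (C n) != 0].
have mB n : measurable (B n).
  rewrite (_ : B n = ~` ((fun xi : M => xi (C n)) @^-1` [set 0])).
    by apply: measurableC; rewrite -[X in measurable X]setTI; exact: mxiC.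
  by apply/seteqP; split => xi /= /eqP.
pose E := seqDU B.
have mE n : measurable (E n) by apply: measurableD => //; exact: bigsetU_measurable.
(* The power [-1] is the inverse, and powers are measurable in their base. *)
pose c n (xi : M) : \bar R := (\1_(E n) xi)%:E * (fine (xi (C n)) `^ (-1))%:E.
have c0 n xi : 0 <= c n xi by apply: mule_ge0; rewrite lee_fin// powR_ge0.
have mc n : measurable_fun setT (c n).
  apply: emeasurable_funM; first exact/measurable_EFinP/measurable_indic.
  apply/measurable_EFinP; apply: (measurableT_comp (measurable_powR _)).
  exact: (measurableT_comp (fine_measurable measurableT) (mxiC n)).
pose kn n (p : M * borel G) : \bar R := c n p.1 * (\1_(C n) p.2)%:E.
have kn0 n p : 0 <= kn n p by apply: mule_ge0; rewrite ?lee_fin.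
have mkn n : measurable_fun setT (kn n).
  by have mcn := mc n; rewrite /kn; measurability_of hG.
exists (fun p => \sum_(n <oo) kn n p); split => [p||xi Nxi].
- by apply: nneseries_ge0 => n _ _.
- by apply: ge0_emeasurable_sum => // n _.
rewrite integral_nneseries//; last first.
  by move=> n; exact: (measurableT_comp (mkn n) (pair1_measurable xi)).
transitivity (\sum_(n <oo) (\1_(E n) xi)%:E : \bar R).
  apply: eq_eseriesr => n _; rewrite /kn /=.
  rewrite ge0_integralZl//; last exact/measurable_EFinP/measurable_indic.
  rewrite integral_indic// setIT /c indicE.
  have [|_] := boolP (xi \in E n); last by rewrite !mul0e.
  rewrite inE mul1e => -[/eqP Bxi _].
  have xifin : xi (C n) \is a fin_num by rewrite ge0_fin_numE.
  rewrite powR_inv1 ?fine_ge0// -[X in _ * X]fineK// -EFinM mulVf//.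
  by apply/eqP => xi0; apply: Bxi; rewrite -[LHS]fineK// xi0.
rewrite -indic_bigcup; last exact: trivIset_seqDU.
rewrite -seqDU_bigcup_eq indicE mem_set//.
by have [n xin] := nonnull_cover mC CT Nxi; exists n.
Qed.

End inversion.

Section mecke_inversion.
Local Open Scope ereal_scope.
Variables (G : topologicalZmodType) (R : realType).
Hypothesis hG : lcsc_group G.
Local Notation M := (lfmeasure G R).
Variable lambda : M.
Hypothesis lambda_haar : haar_measure lambda.
Let mnull := @measurable_null_lfmeasure G R hG.

Lemma campbell_palm (P Q : {measure set M -> \bar R}) :
  campbell lambda P Q -> is_palm_measure lambda P Q.
Proof.
move=> camp omega momega omega0 omega1 A mA.
have := camp (fun p => (omega p.2)%:E * (\1_A p.1)%:E).
rewrite /= => ->; last 2 first.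
- by nonnegativity.
- by measurability_of hG.
rewrite -[A in LHS]setIT -integral_indic//; apply: eq_integral => xi _.
rewrite ge0_integralZr//; last 2 first.
- by measurability_of hG.
- by move=> t _; rewrite lee_fin.
by rewrite omega1 mul1e.
Qed.

Lemma palm_null (P Q : {measure set M -> \bar R}) :
  is_palm_measure lambda P Q -> Q (@null_lfmeasure G R) = 0.
Proof.
move=> palm.
have [omega [momega omega0 _ omega1]] := symmetric_density hG lambda_haar.
rewrite (palm omega)//; apply: integral0_eq => xi _.
have [xiN|xiN] := pselect (null_lfmeasure xi).
  under eq_integral do rewrite EFinM.
  by apply: integral_null => //; measurability_of hG.
apply: integral0_eq => t _; rewrite indicE memNset ?mulr0//.
by move=> /null_tau.
Qed.

Section given_palm_measure.
Variable Q : {measure set M -> \bar R}.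
Hypothesis sQ : sigma_finite setT Q.
Hypothesis meckeQ : mecke Q.
Hypothesis Qnull : Q (@null_lfmeasure G R) = 0.

(** The inversion formula that recovers a stationary measure from its Palm
    measure [Q], for the weight [k]. *)
Definition inverts (k : M * borel G -> \bar R) (P : set M -> \bar R) :=
  forall A, measurable A -> P A = \int[Q]_eta \int[lambda]_s
    (k (@tau G R (- s)%R eta, s) * (\1_A (@tau G R (- s)%R eta))%:E).

Lemma exists_inverts k : normalizing k ->
  exists P : {measure set M -> \bar R}, inverts k P.
Proof.
move=> [k0 mk _].
have [|p|||P PE] := @mixture_measure _ _ _ _ _ _ _ Q
  (fun _ : M => lf_measure lambda) _
  (fun p : M * borel G => k (@tau G R (- p.2)%R p.1, p.2))
  (fun p => @tau G R (- p.2)%R p.1).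
- by move=> f f0 mf; measurability_of hG.
- by nonnegativity.
- by measurability_of hG.
- by measurability_of hG.
by exists P => A _; exact: PE.
Qed.

Variables (k : M * borel G -> \bar R) (P : {measure set M -> \bar R}).
Hypotheses (nk : normalizing k) (kP : inverts k P).

Lemma integral_inverts (f : M -> \bar R) :
  (forall xi, 0 <= f xi) -> measurable_fun setT f ->
  \int[P]_xi f xi = \int[Q]_eta \int[lambda]_s
    (k (@tau G R (- s)%R eta, s) * f (@tau G R (- s)%R eta)).
Proof.
move=> f0 mf; have [k0 mk _] := nk.
apply: (@integral_mixture _ _ _ _ _ _ _ Q (fun _ : M => lf_measure lambda) _
  (fun p : M * borel G => k (@tau G R (- p.2)%R p.1, p.2))
  (fun p => @tau G R (- p.2)%R p.1)) => //=.
- by move=> g g0 mg; measurability_of hG.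
- by measurability_of hG.
- by measurability_of hG.
Qed.

(** Expand the left side by the inversion formula, exchange the integrals over
    [s] and [t] and shift [s] by [- t]: the integrand depends on [tau t eta] and
    [- t] only.  After Mecke's identity the weight [k] integrates to 1. *)
Lemma inverts_campbell : campbell lambda P Q.
Proof.
move=> f f0 mf; have [k0 mk k1] := nk.
rewrite (integral_inverts (f := fun xi => \int[xi]_t f (@tau G R t xi, t)));
  last 2 first.
- by nonnegativity.
- by measurability_of hG.
transitivity (\int[Q]_eta \int[eta]_t \int[lambda]_s
    (k (@tau G R (- s)%R (@tau G R t eta), (s - t)%R) * f (@tau G R t eta, s))).
  apply: eq_integral => eta _.
  transitivity (\int[lambda]_s \int[eta]_t
      (k (@tau G R (- s)%R eta, s) * f (@tau G R t eta, (t + s)%R))).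
    apply: eq_integral => s _; rewrite integral_tau; last 2 first.
    - by nonnegativity.
    - by measurability_of hG.
    rewrite -ge0_integralZl//; last by measurability_of hG.
    apply: eq_integral => t _; rewrite opprK tau_tau.
    by rewrite [(- s + _)%R]addrC addrK.
  rewrite (tonelli (m1 := lambda) (m2 := eta) (f := fun q : borel G * borel G =>
    k (@tau G R (- q.1)%R eta, q.1) *
    f (@tau G R q.2 eta, (q.2 + q.1)%R))); last 4 first.
  - exact: sigma_finite_lf.
  - exact: sigma_finite_lf.
  - by nonnegativity.
  - by measurability_of hG.
  apply: eq_integral => t _ /=.
  rewrite -(haar_shift lambda_haar (- t)%R); last 2 first.
  - by nonnegativity.
  - by measurability_of hG.
  apply: eq_integral => s _.
  by rewrite tau_tau opprB [(t + (s - t))%R]addrC subrK.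
rewrite (meckeQ (h := fun p => \int[lambda]_s
    (k (@tau G R (- s)%R p.1, (s + p.2)%R) * f (p.1, s))))/=; last 2 first.
- by nonnegativity.
- by measurability_of hG.
apply: (eq_integral_off_null mnull) => //.
- by nonnegativity.
- by measurability_of hG.
- by nonnegativity.
- by measurability_of hG.
move=> eta etaN.
rewrite (tonelli (m1 := eta) (m2 := lambda) (f := fun q : borel G * borel G =>
  k (@tau G R (- q.2)%R eta, (q.2 + q.1)%R) * f (eta, q.2))); last 4 first.
- exact: sigma_finite_lf.
- exact: sigma_finite_lf.
- by nonnegativity.
- by measurability_of hG.
apply: eq_integral => s _ /=.
rewrite ge0_integralZr//; last by measurability_of hG.
rewrite -[RHS]mul1e; congr (_ * _).
rewrite -(k1 (@tau G R (- s)%R eta)); last by move=> /null_tau.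
rewrite integral_tau//; last by measurability_of hG.
by apply: eq_integral => r _; rewrite opprK addrC.
Qed.

Lemma inverts_null : P (@null_lfmeasure G R) = 0.
Proof.
have [k0 mk _] := nk.
rewrite kP//.
rewrite (eq_integral_off_null mnull Qnull (g := cst 0))//.
- by rewrite integral_cst// mul0e.
- by nonnegativity.
- by measurability_of hG.
move=> eta etaN; apply: integral0_eq => s _.
by rewrite indicE memNset ?mule0// => /null_tau.
Qed.

(** [P] was built with [k], but the Campbell identity for [P] and [Q], applied to
    a function made of [k'], rewrites [P] as the measure built with [k']. *)
Lemma inverts_unique k' : normalizing k' -> inverts k' P.
Proof.
move=> [k'0 mk' k'1] A mA.
have := inverts_campbell (f := fun p =>
  k' (@tau G R (- p.2)%R p.1, p.2) * (\1_A (@tau G R (- p.2)%R p.1))%:E).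
rewrite /= => <-; last 2 first.
- by nonnegativity.
- by measurability_of hG.
rewrite -[A in LHS]setIT -integral_indic//.
apply: (eq_integral_off_null mnull inverts_null).
- by nonnegativity.
- by measurability_of hG.
- by nonnegativity.
- by measurability_of hG.
move=> xi xiN; under [RHS]eq_integral do rewrite tau_tau subrr tau0.
rewrite ge0_integralZr//; last by measurability_of hG.
by rewrite k'1// mul1e.
Qed.

(** The image of [P] under [tau u] is the measure built with a translate of [k],
    which is normalised too. *)
Lemma inverts_stationary : stationary P.
Proof.
have [k0 mk k1] := nk.
split; last exact: inverts_null.
move=> u A mA; rewrite /pushforward.
have mtauA : measurable (@tau G R u @^-1` A).
  rewrite -[X in measurable X]setTI.
  have mu : measurable_fun setT (@tau G R u) by measurability_of hG.
  exact: mu.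
rewrite kP//.
have nk' : normalizing (fun p => k (@tau G R (- u)%R p.1, (p.2 + u)%R)).
  split => [p||xi xiN]; first exact: k0.
    by measurability_of hG.
  rewrite /= -(k1 (@tau G R (- u)%R xi)); last by move=> /null_tau.
  rewrite integral_tau//; last by measurability_of hG.
  by apply: eq_integral => s _; rewrite opprK.
rewrite (inverts_unique nk' mA); apply: eq_integral => eta _.
rewrite -(haar_shift lambda_haar u); last 2 first.
- by nonnegativity.
- by measurability_of hG.
apply: eq_integral => s _; rewrite /= tau_tau -opprD; congr (_ * _).
rewrite !indicE; congr ((_ : bool)%:R)%:E.
have E : @tau G R u (@tau G R (- (s + u))%R eta) = @tau G R (- s)%R eta.
  by rewrite tau_tau opprD subrK.
apply/idP/idP => /set_mem Am; apply/mem_set; first by rewrite -E.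
by change (A (@tau G R u (@tau G R (- (s + u))%R eta))); rewrite E.
Qed.

(** The mass that [xi] gives to the points [t] of [C] with [tau t xi] in [A] has
    integral [lambda C * Q A] under [P].  When [C] and [A] range over countable
    covers by sets of finite measure, these functionals have finite integrals
    and vanish simultaneously only on null configurations. *)
Lemma inverts_sigma_finite : sigma_finite setT P.
Proof.
have [A AT mA] := sQ.
have {}mA' n : measurable (A n) by have [] := mA n.
have [C [mC Cfin CT]] := finite_cover R hG.
pose f (i : nat * nat) (xi : M) :=
  \int[xi]_t ((\1_(C i.1) t)%:E * (\1_(A i.2) (@tau G R t xi))%:E).
apply: (@sigma_finite_of_integrable _ _ _ _ _ _ f mnull inverts_null).
- by rewrite /f; nonnegativity.
- by move=> i; rewrite /f; measurability_of hG.
- move=> [j n]; rewrite /f /=.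
  have := inverts_campbell (f := fun p => (\1_(C j) p.2)%:E * (\1_(A n) p.1)%:E).
  rewrite /= => ->; last 2 first.
  + by nonnegativity.
  + by measurability_of hG.
  rewrite (_ : integral _ _ _ = lambda (C j) * Q (A n)).
    by rewrite lte_mul_pinfty// ?ge0_fin_numE//; have [] := mA n.
  rewrite -[A n in RHS]setIT -integral_indic// -ge0_integralZl//; last first.
    by measurability_of hG.
  apply: eq_integral => eta _; rewrite ge0_integralZr//; last by measurability_of hG.
  by rewrite integral_indic// setIT.
move=> xi; apply: contra_notP => /forallNP xi0; apply/null_lfmeasureE.
rewrite -CT; apply: measure_bigcup_eq0 => // j.
have mtau : measurable_fun setT (fun t : borel G => @tau G R t xi).
  by measurability_of hG.
have mtauA n : measurable ((fun t : borel G => @tau G R t xi) @^-1` A n).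
  by rewrite -[X in measurable X]setTI; exact: mtau.
rewrite (_ : C j = \bigcup_n (C j `&` (fun t : borel G => @tau G R t xi) @^-1` A n)).
  apply: measure_bigcup_eq0 => n; first exact: measurableI.
  have /negP/negPn/eqP <- := xi0 (j, n).
  rewrite -[X in xi X]setIT -integral_indic//; last exact: measurableI.
  apply: eq_integral => t _; rewrite /= -EFinM !indicE -natrM mulnb in_setI.
  by [].
by rewrite -setI_bigcupr -preimage_bigcup -AT preimage_setT setIT.
Qed.

End given_palm_measure.

(** Mecke's characterisation of Palm measures. *)
Lemma mecke_palm_inversion (Q : {measure set M -> \bar R}) :
  sigma_finite setT Q -> mecke Q -> Q (@null_lfmeasure G R) = 0 ->
  exists P : {sigma_finite_measure set M -> \bar R},
    stationary P /\ is_palm_measure lambda P Q.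
Proof.
move=> sQ mQ QN.
have [k nk] := exists_normalizing R hG.
have [P kP] := exists_inverts Q nk.
have [P' PE] := sigma_finite_upgrade (inverts_sigma_finite sQ mQ QN nk kP).
exists P'; rewrite PE; split; first exact: (inverts_stationary mQ QN nk kP).
exact/campbell_palm/(inverts_campbell mQ QN nk kP).
Qed.

End mecke_inversion.

(** * The displaced measure is a Palm measure *)

Theorem theorem3p1 (R : realType) (G : topologicalZmodType)
  (G_hausdorff : hausdorff_space G)
  (G_locally_compact : locally_compact [set: G])
  (G_second_countable : @second_countable G)
  (lambda : lfmeasure G R) (lambda_haar : haar_measure lambda)
  (P : {sigma_finite_measure set (lfmeasure G R) -> \bar R})
  (P_stationary : stationary P)
  (P0 : {sigma_finite_measure set (lfmeasure G R) -> \bar R})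
  (P0_palm : is_palm_measure lambda P P0)
  (nu : {sigma_finite_measure set (displacement G R) -> \bar R})
  (nu_weakly_stationary : weakly_stationary nu)
  (P0nu_sigma_finite :
    sigma_finite [set: lfmeasure G R]
      (pushforward (P0 \x nu)%E (@Gamma G R))) :
  exists Pnu : {sigma_finite_measure set (lfmeasure G R) -> \bar R},
    stationary Pnu /\
    is_palm_measure lambda Pnu (pushforward (P0 \x nu)%E (@Gamma G R)).
Proof.
have hG := LcscGroup G_hausdorff G_locally_compact G_second_countable.
have mGamma : measurable_fun setT (@Gamma G R).
  rewrite (_ : @Gamma G R = fun p => Gamma (p.1, p.2)).
    by measurability_of hG.
  by apply/funext => -[].
pose Q := measure_function_pushforward__canonical__measure_function_Measure
  (P0 \x nu)%E mGamma.
have sP0 : sigma_finite setT P0 by exact: sigma_finiteT.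
have snu : sigma_finite setT nu by exact: sigma_finiteT.
have sP : sigma_finite setT P by exact: sigma_finiteT.
have QE (g : lfmeasure G R -> \bar R) : (forall xi, 0 <= g xi)%E ->
    measurable_fun setT g ->
    (\int[Q]_eta g eta = \int[P0]_xi \int[nu]_B g (Gamma (xi, B)))%E.
  move=> g0 mg.
  rewrite (integral_image (m := (P0 \x nu)%E) (n := Q) mGamma)//.
  rewrite fubini_tonelli1//.
  exact: measurableT_comp.
have meckeP0 : mecke P0.
  apply: (campbell_mecke hG lambda_haar).
  exact: (palm_campbell hG lambda_haar sP sP0 P_stationary P0_palm).
have mnull := @measurable_null_lfmeasure G R hG.
apply: (@mecke_palm_inversion G R hG lambda lambda_haar Q) => //.
  exact: (mecke_displaced hG sP0 snu nu_weakly_stationary QE meckeP0).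
rewrite -[X in Q X]setIT -integral_indic// QE; last 2 first.
- by move=> xi; rewrite lee_fin.
- exact/measurable_EFinP/measurable_indic.
have P0null := palm_null hG lambda_haar P0_palm.
rewrite (eq_integral_off_null mnull P0null (g := cst 0%E))//.
- by rewrite integral_cst// mul0e.
- by nonnegativity.
- by measurability_of hG.
move=> xi xiN; apply: integral0_eq => B _.
by rewrite indicE memNset// => /null_Gamma.
Qed.
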